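(* Let $q,a,b$ be nonzero complex numbers with $|q|<1$ and $\max\{|ab/q|,|aq^2|,|bq^2|\}<1$. Then $$\frac{(q^2,ab;q^2)_\infty}{(aq^2,bq^2;q^2)_\infty}\;{}_3\phi_2\left(\begin{matrix}q^2/a,\,q^2/b,\,-1\\ q,\,-q^2\end{matrix};q^2,ab/q\right)=\sum_{n=0}^\infty\sum_{j=-n}^n(1-q^{4n+2})\frac{(q^2/a,q^2/b;q^2)_n}{(aq^2,bq^2;q^2)_n}(ab)^nq^{n^2-n-j^2}.$$
   Context: Notation, for a base $p$ with $|p|<1$: $(x;p)_0=1$, $(x;p)_n=\prod_{k=0}^{n-1}(1-xp^k)$, $(x;p)_\infty=\prod_{k=0}^\infty(1-xp^k)$, $(x_1,\dots,x_k;p)_n=(x_1;p)_n\cdots(x_k;p)_n$ (also for $n=\infty$), and $${}_3\phi_2\left(\begin{matrix}A_1,A_2,A_3\\ B_1,B_2\end{matrix};p,z\right)=\sum_{n=0}^\infty\frac{(A_1,A_2,A_3;p)_n}{(p,B_1,B_2;p)_n}z^n .$$ *)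

(* Defs.v *)
From HB Require Import structures.
From mathcomp Require Import all_boot all_order all_algebra.
From mathcomp Require Import complex.
From mathcomp Require Import all_classical all_reals all_analysis.

Set Implicit Arguments.
Unset Strict Implicit.
Unset Printing Implicit Defensive.

Import Order.TTheory GRing.Theory Num.Theory.
Import numFieldNormedType.Exports.

Local Open Scope classical_set_scope.
Local Open Scope ring_scope.

(* Base-p q-Pochhammer symbol (x; p)_n *)
Definition qpoch (K : numFieldType) (x p : K) (n : nat) : K :=
  \prod_(k < n) (1 - x * p ^+ k).

(* (x; p)_oo; [limn] is total, the limit exists as soon as `|p| < 1 *)
Definition qpoch_inf (K : numFieldType) (x p : K) : K :=
  limn (fun n => qpoch x p n).

(* (x_1, ..., x_k; p)_n and (x_1, ..., x_k; p)_oo, for xs = [:: x_1; ...; x_k] *)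
Definition qpochs (K : numFieldType) (xs : seq K) (p : K) (n : nat) : K :=
  \prod_(x <- xs) qpoch x p n.

Definition qpochs_inf (K : numFieldType) (xs : seq K) (p : K) : K :=
  \prod_(x <- xs) qpoch_inf x p.

(* Convergence and sum of the series of the u n; [sum_series u] is only meaningful
   when [cvg_series u] holds. *)
Definition cvg_series (K : numFieldType) (u : nat -> K) : Prop :=
  cvgn (series u).

Definition sum_series (K : numFieldType) (u : nat -> K) : K :=
  limn (series u).

Definition phi32_term (K : numFieldType) (A1 A2 A3 B1 B2 p z : K) (n : nat) : K :=
  qpochs [:: A1; A2; A3] p n / qpochs [:: p; B1; B2] p n * z ^+ n.

Definition phi32 (K : numFieldType) (A1 A2 A3 B1 B2 p z : K) : K :=
  sum_series (phi32_term A1 A2 A3 B1 B2 p z).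

(* the integers -n, ..., n *)
Definition sym_range (n : nat) : seq int :=
  [seq i%:Z - n%:Z | i <- iota 0 n.*2.+1].

(* Main.v *)
(* The 3phi2 series is sum_N (q^2/a, q^2/b; q^2)_N (ab)^N beta_N, where beta_N is
   the second member of a Bailey pair relative to q^2 (in base q^2) with
   alpha_n = (1 - q^(4n+2)) q^(n^2-n) sum_{|j| <= n} q^(-j^2).  Substituting
   beta_N = sum_{n <= N} alpha_n / ((q^2; q^2)_(N-n) (q^2; q^2)_(N+n+1)) and
   exchanging the sums leaves inner sums over N that the q-Gauss formula
   evaluates.  The Bailey pair itself reduces, after telescoping over n, to
   sum_k q^k / ((q^2; q^2)_k (q^2; q^2)_(M-k)) = 1 / (q; q)_M.
   The exchange and the q-Gauss formula both rest on Tannery's theorem. *)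
Require Import Defs.
From HB Require Import structures.
From mathcomp Require Import all_boot all_order all_algebra.
From mathcomp Require Import complex.
From mathcomp Require Import all_classical all_reals all_analysis.
From mathcomp Require Import ring zify.

Set Implicit Arguments.
Unset Strict Implicit.
Unset Printing Implicit Defensive.

Import Order.TTheory GRing.Theory Num.Theory.
Import numFieldNormedType.Exports.

Local Open Scope classical_set_scope.
Local Open Scope ring_scope.
Local Open Scope complex_scope.

(* A form of completeness that covers both [R] and [R[i]], the latter not being
   an instance of a complete normed module in the library. *)
Definition geom_complete (K : numFieldType) : Prop :=
  forall (u : nat -> K) (c r : K), 0 <= r -> r < 1 ->
    (forall n, `|u n| <= c * r ^+ n) -> cvg_series u.

(** * Limits, geometric tails and Tannery's theorem *)

Lemma cvgn_epsP (K : numFieldType) (u : nat -> K) (l : K) :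
  u @ \oo --> l <->
  (forall e, 0 < e -> exists N, forall n, (N <= n)%N -> `|l - u n| < e).
Proof.
split=> [/cvgrPdist_lt h e /h [N _ hN]|h]; first by exists N.
by apply/cvgrPdist_lt => e /h [N hN]; exists N.
Qed.

Lemma limn_eq (K : numFieldType) (u : nat -> K) (l : K) :
  u @ \oo --> l -> limn u = l.
Proof. exact/cvg_lim/norm_hausdorff. Qed.

Lemma limn_dist_le (K : numFieldType) (u : nat -> K) (l x B : K) (N : nat) :
  u @ \oo --> l -> (forall n, (N <= n)%N -> `|u n - x| <= B) -> `|l - x| <= B.
Proof.
move=> /cvgn_epsP h hB; apply/ler_addgt0Pl => e /h [M hM].
have -> : l - x = (l - u (maxn M N)) + (u (maxn M N) - x) by ring.
apply: le_trans (ler_normD _ _) _; apply: lerD.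
  exact/ltW/hM/leq_maxl.
exact/hB/leq_maxr.
Qed.

Lemma sum_geom_le (K : numFieldType) (c r : K) (m n : nat) :
  0 <= c -> 0 <= r -> r < 1 ->
  \sum_(m <= k < n) c * r ^+ k <= c / (1 - r) * r ^+ m.
Proof.
move=> c0 r0 r1; have r1' : 0 < 1 - r by rewrite subr_gt0.
have [nm|mn] := leqP n m.
  by rewrite big_geq// mulr_ge0 ?exprn_ge0// divr_ge0// ltW.
have -> : \sum_(m <= k < n) c * r ^+ k = c / (1 - r) * (r ^+ m - r ^+ n).
  transitivity (- (c / (1 - r) * r ^+ n) - - (c / (1 - r) * r ^+ m)); last by ring.
  rewrite -(telescope_sumr (fun k => - (c / (1 - r) * r ^+ k)) (ltnW mn)).
  by apply: eq_bigr => k _; rewrite exprS; field; rewrite lt0r_neq0.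
apply: ler_wpM2l; first by rewrite divr_ge0 // ltW.
by rewrite lerBlDr lerDl exprn_ge0.
Qed.

Lemma geom_bound_ge0 (K : numFieldType) (u : nat -> K) (c r : K) :
  (forall n, `|u n| <= c * r ^+ n) -> 0 <= c.
Proof. by move=> /(_ 0%N); rewrite expr0 mulr1; apply: le_trans. Qed.

Lemma sum_series_dist_le (K : numFieldType) (u : nat -> K) (c r : K) (n : nat) :
  geom_complete K -> 0 <= r -> r < 1 -> (forall n, `|u n| <= c * r ^+ n) ->
  `|sum_series u - series u n| <= c / (1 - r) * r ^+ n.
Proof.
move=> hK r0 r1 hu; have c0 := geom_bound_ge0 hu.
apply: (@limn_dist_le _ (series u) _ _ _ n); first exact: hK r0 r1 hu.
move=> m nm; rewrite sub_series_geq//.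
apply: le_trans (ler_norm_sum _ _ _) _.
apply: le_trans (sum_geom_le n m c0 r0 r1).
by apply: ler_sum => k _; exact: hu.
Qed.

(** Over a general [numFieldType] the powers of r < 1 need not tend to 0. Here they do because
    [geom_complete] makes the geometric series converge. *)
Lemma geom_cvg0 (K : numFieldType) (c r : K) :
  geom_complete K -> 0 <= r -> r < 1 -> (fun n => c * r ^+ n) @ \oo --> 0.
Proof.
move=> hK r0 r1; apply: cvg_series_cvg_0.
apply: (hK _ `|c| r r0 r1) => // n.
by rewrite normrM normrX (ger0_norm r0).
Qed.

Lemma geom_small (K : numFieldType) (c r e : K) :
  geom_complete K -> 0 <= c -> 0 <= r -> r < 1 -> 0 < e ->
  exists N, c * r ^+ N < e.
Proof.
move=> hK c0 r0 r1 e0.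
have /cvgn_epsP /(_ _ e0) [N /(_ N (leqnn N))] := geom_cvg0 c hK r0 r1.
rewrite sub0r normrN ger0_norm ?mulr_ge0 ?exprn_ge0// => h.
by exists N.
Qed.

(** An e/3 argument: the geometric bound, inherited by [g], makes the tails beyond some N small
    uniformly in M; the first N terms form a finite sum and converge termwise. *)
Lemma tannery (K : numFieldType) (f : nat -> nat -> K) (g : nat -> K) (c r : K) :
  geom_complete K -> 0 <= r -> r < 1 ->
  (forall M n, `|f M n| <= c * r ^+ n) ->
  (forall n, f ^~ n @ \oo --> g n) ->
  cvg_series g /\ (fun M => sum_series (f M)) @ \oo --> sum_series g.
Proof.
move=> hK r0 r1 hf fg.
have c0 := geom_bound_ge0 (hf 0%N).
have hg n : `|g n| <= c * r ^+ n.
  rewrite -[g n]subr0; apply: (@limn_dist_le _ _ _ _ _ 0%N (fg n)) => M _.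
  by rewrite subr0; exact: hf.
split; first exact: hK r0 r1 hg.
apply/cvgn_epsP => e e0.
have c1 : 0 <= c / (1 - r) by rewrite divr_ge0 // subr_ge0 ltW.
have e3 : 0 < e / 3 by rewrite divr_gt0.
have [N hN] := geom_small hK c1 r0 r1 e3.
have : (fun M => series (f M) N) @ \oo --> series g N.
  rewrite !seriesEnat.
  by apply: cvg_big => [|n _]; [exact: add_continuous | exact: fg].
move=> /cvgn_epsP /(_ _ e3) [M0 hM0]; exists M0 => M /hM0 hM.
have -> : sum_series g - sum_series (f M) =
  (sum_series g - series g N) + (series g N - series (f M) N)
    + (series (f M) N - sum_series (f M)) by ring.
have -> : e = e / 3 + e / 3 + e / 3 by field.
apply: le_lt_trans (ler_normD _ _) _.
apply: ltrD; last first.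
  rewrite distrC; apply: le_lt_trans hN.
  exact: sum_series_dist_le.
apply: le_lt_trans (ler_normD _ _) _.
apply: ltrD => //; apply: le_lt_trans hN.
exact: sum_series_dist_le.
Qed.

(** * Geometric completeness of the real and complex numbers *)

Lemma real_geom_complete (R : realType) : geom_complete R.
Proof.
move=> u c r r0 r1 hu; apply: normed_cvg.
have r1' : `|r| < 1 by rewrite ger0_norm.
apply: (series_le_cvg _ _ hu (is_cvg_geometric_series (a := c) r1')) => n //.
exact: le_trans (hu n).
Qed.

Lemma complex_geom_complete (R : realType) : geom_complete R[i].
Proof.
move=> u c r r0 r1 hu.
have c0 := geom_bound_ge0 hu.
(* Nonnegative elements of [R[i]] are real, so c and r come from [R] and the same real geometric
   bound governs both the real and the imaginary parts. *)
have er : r = (complex.Re r)%:C by rewrite RRe_real // ger0_real.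
have ec : c = (complex.Re c)%:C by rewrite RRe_real // ger0_real.
move: er ec hu r0 r1 {c0}; move: (complex.Re r) (complex.Re c) => r' c' -> -> hu.
rewrite -(rmorph0 (real_complex R)) -(rmorph1 (real_complex R)) lecR ltcR.
move=> r0 r1.
have hRe n : `|complex.Re (u n)| <= c' * r' ^+ n.
  rewrite -lecR rmorphM rmorphXn; apply: le_trans (hu n).
  exact: normc_ge_Re.
have hIm n : `|complex.Im (u n)| <= c' * r' ^+ n.
  rewrite -lecR rmorphM rmorphXn; apply: le_trans (hu n).
  (* Up to sign, the imaginary part of z is the real part of iz. *)
  have := normc_ge_Re (u n * 'i).
  rewrite ReiNIm normrN normrM.
  by rewrite [`|'i|]normc_def /= expr0n expr1n add0r sqrtr1 mulr1.
have cRe := real_geom_complete r0 r1 hRe.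
have cIm := real_geom_complete r0 r1 hIm.
pose l : R[i] := (sum_series (fun k => complex.Re (u k)))%:C
    + 'i * (sum_series (fun k => complex.Im (u k)))%:C.
suff h : forall e : R[i], 0 < e ->
    exists N, forall n, (N <= n)%N -> `|l - series u n| < e.
  by apply/cvg_ex; exists l; exact/cvgn_epsP.
move=> e e0.
have ee : e = (complex.Re e)%:C by rewrite RRe_real // ger0_real // ltW.
move: e0; rewrite ee -(rmorph0 (real_complex R)) ltcR => e0 {ee}.
have e2 : 0 < complex.Re e / 2 by rewrite divr_gt0.
have /cvgn_epsP /(_ _ e2) [N1 hN1] := cRe.
have /cvgn_epsP /(_ _ e2) [N2 hN2] := cIm.
exists (maxn N1 N2) => n; rewrite geq_max => /andP [n1 n2].
have -> : series u n = (series (fun k => complex.Re (u k)) n)%:C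
    + 'i * (series (fun k => complex.Im (u k)) n)%:C.
  rewrite !seriesEnat /= !rmorph_sum mulr_sumr -big_split /=.
  by apply: eq_bigr => k _; exact: complexE.
rewrite opprD addrACA -mulrBr -!rmorphB.
apply: le_lt_trans (ler_normD _ _) _.
rewrite normrM [`|'i|]normc_def /= expr0n expr1n add0r sqrtr1 mul1r.
rewrite ![`|_%:C|]normc_def /= !expr0n !addr0 !sqrtr_sqr -rmorphD ltcR.
rewrite [X in _ < X]splitr; apply: ltrD; first exact: hN1.
exact: hN2.
Qed.

(** * Uniform bounds and limits of q-Pochhammer symbols *)

(** Induction proves the stronger fact that (1 - s) times the product is at most 1 - s r^n; each
    step loses only the nonnegative amount (1 - r) (s r^n)^2. *)
Lemma prod_geom_le (K : numFieldType) (s r : K) (n : nat) :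
  0 <= s -> s < 1 -> 0 <= r -> r < 1 ->
  \prod_(k < n) (1 + s * (1 - r) * r ^+ k) <= (1 - s)^-1.
Proof.
move=> s0 s1 r0 r1; have s1' : 0 < 1 - s by rewrite subr_gt0.
have r1' : 0 <= 1 - r by rewrite subr_ge0 ltW.
rewrite -[leRHS]mul1r ler_pdivlMr//.
apply: (@le_trans _ _ (1 - s * r ^+ n)); last first.
  by rewrite lerBlDr lerDl mulr_ge0 ?exprn_ge0.
elim: n => [|n IHn]; first by rewrite big_ord0 mul1r expr0 mulr1.
rewrite big_ord_recr /= mulrAC.
have rn0 : 0 <= r ^+ n by rewrite exprn_ge0.
have c0 : 0 <= s * (1 - r) * r ^+ n by rewrite !mulr_ge0.
apply: le_trans (_ : (1 - s * r ^+ n) * (1 + s * (1 - r) * r ^+ n) <= _).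
  by apply: ler_wpM2r => //; rewrite addr_ge0.
rewrite -subr_ge0.
have -> : 1 - s * r ^+ n.+1 - (1 - s * r ^+ n) * (1 + s * (1 - r) * r ^+ n)
  = s * r ^+ n * (s * (1 - r) * r ^+ n) by rewrite exprS; ring.
by rewrite mulr_ge0 // mulr_ge0.
Qed.

(** Choosing N with s = c r^N / (1 - r) < 1, the first N factors are a constant and the remaining
    ones have the form treated in [prod_geom_le]. *)
Lemma prod_geom_bound (K : numFieldType) (c r : K) :
  geom_complete K -> 0 <= c -> 0 <= r -> r < 1 ->
  exists2 B, 0 < B & forall n, \prod_(k < n) (1 + c * r ^+ k) <= B.
Proof.
move=> hK c0 r0 r1; have r1' : 0 < 1 - r by rewrite subr_gt0.
have s0 : 0 <= c / (1 - r) by rewrite divr_ge0 // ltW.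
have [N hN] := geom_small hK s0 r0 r1 ltr01.
set s := c / (1 - r) * r ^+ N in hN.
have s0' : 0 <= s by rewrite mulr_ge0 // exprn_ge0.
have ge1 n : 1 <= 1 + c * r ^+ n by rewrite lerDl mulr_ge0 ?exprn_ge0.
have P0 n : 0 < \prod_(k < n) (1 + c * r ^+ k).
  by apply: prodr_gt0 => k _; apply: lt_le_trans (ge1 _).
exists ((\prod_(k < N) (1 + c * r ^+ k)) * (1 - s)^-1) => [|n].
  by rewrite mulr_gt0 // invr_gt0 subr_gt0.
(* All factors are at least 1, so lengthening the product to N + n factors treats n < N and n >= N
   alike. *)
apply: (@le_trans _ _ (\prod_(k < N + n) (1 + c * r ^+ k))).
  rewrite addnC big_split_ord /= -[leLHS]mulr1 ler_pM2l ?P0 //.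
  by elim/big_ind : _ => // x y; exact: mulr_ege1.
rewrite big_split_ord /= ler_pM2l ?P0 //.
apply: le_trans (prod_geom_le n s0' hN r0 r1).
apply: ler_prod => k _; apply/andP; split.
  exact: le_trans (ge1 _).
rewrite /s exprD lerD2l // le_eqVlt; apply/orP; left; apply/eqP.
by field; rewrite lt0r_neq0.
Qed.

Lemma qpochS (K : numFieldType) (x p : K) (n : nat) :
  qpoch x p n.+1 = qpoch x p n * (1 - x * p ^+ n).
Proof. by rewrite /qpoch big_ord_recr. Qed.

Lemma qpoch0 (K : numFieldType) (x p : K) : qpoch x p 0 = 1.
Proof. by rewrite /qpoch big_ord0. Qed.

Lemma qpochD (K : numFieldType) (x p : K) (n m : nat) :
  qpoch x p (n + m) = qpoch x p n * qpoch (x * p ^+ n) p m.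
Proof.
rewrite /qpoch big_split_ord /=; congr (_ * _).
by apply: eq_bigr => k _; rewrite exprD mulrA.
Qed.

Lemma qpoch_bound (K : numFieldType) (p c : K) :
  geom_complete K -> `|p| < 1 -> 0 <= c ->
  exists2 B, 0 < B & forall x n, `|x| <= c -> `|qpoch x p n| <= B.
Proof.
move=> hK p1 c0; have [B B0 hB] := prod_geom_bound hK c0 (normr_ge0 p) p1.
exists B => // x n xc; apply: le_trans (hB n).
rewrite normr_prod; apply: ler_prod => k _; rewrite normr_ge0 /=.
apply: le_trans (ler_normB _ _) _; rewrite normr1 lerD2l normrM normrX.
by apply: ler_wpM2r => //; exact: exprn_ge0.
Qed.

Lemma norm_qfactor_lt1 (K : numFieldType) (x p : K) (n : nat) :
  `|x| < 1 -> `|p| < 1 -> `|x * p ^+ n| < 1.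
Proof.
move=> x1 p1; rewrite normrM normrX; apply: le_lt_trans x1.
by rewrite ler_piMr // exprn_ile1 // ltW.
Qed.

Lemma subr1_neq0 (K : numFieldType) (x : K) : `|x| < 1 -> 1 - x != 0.
Proof.
move=> x1; rewrite subr_eq0; apply/eqP => e.
by move: x1; rewrite -e normr1 ltxx.
Qed.

Lemma qpoch_neq0 (K : numFieldType) (x p : K) (n : nat) :
  `|x| < 1 -> `|p| < 1 -> qpoch x p n != 0.
Proof.
move=> x1 p1; apply/prodf_neq0 => k _.
exact/subr1_neq0/norm_qfactor_lt1.
Qed.

(** For 0 <= y <= c one has 1 / (1 - y) <= 1 + y / (1 - c); with y = c |p|^k this reduces to
    [prod_geom_bound]. Uniformity in x matters because the lower parameter of the q-Gauss series
    will vary. *)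
Lemma qpoch_inv_bound (K : numFieldType) (p c : K) :
  geom_complete K -> `|p| < 1 -> 0 <= c -> c < 1 ->
  exists2 B, 0 < B & forall x n, `|x| <= c -> `|(qpoch x p n)^-1| <= B.
Proof.
move=> hK p1 c0 c1; have c1' : 0 < 1 - c by rewrite subr_gt0.
have d0 : 0 <= c / (1 - c) by rewrite divr_ge0 // ltW.
have [B B0 hB] := prod_geom_bound hK d0 (normr_ge0 p) p1.
exists B => // x n xc; apply: le_trans (hB n).
rewrite /qpoch -prodfV normr_prod; apply: ler_prod => k _; rewrite normr_ge0 /=.
have pk1 : `|p| ^+ k <= 1 by rewrite exprn_ile1 // ltW.
have pk0 : 0 <= `|p| ^+ k by exact: exprn_ge0.
have y0 : 0 <= c * `|p| ^+ k by rewrite mulr_ge0.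
have yc : c * `|p| ^+ k <= c by rewrite ler_piMr.
have y1 : 0 < 1 - c * `|p| ^+ k.
  by rewrite subr_gt0; exact: le_lt_trans c1.
have lb : 1 - c * `|p| ^+ k <= `|1 - x * p ^+ k|.
  apply: le_trans (lerB_dist _ _).
  rewrite normr1 lerD2l lerN2 normrM normrX.
  by apply: ler_wpM2r.
rewrite normfV; apply: (@le_trans _ _ (1 - c * `|p| ^+ k)^-1).
  by rewrite lef_pV2 ?posrE //; exact: lt_le_trans lb.
rewrite -[leLHS]mul1r ler_pdivrMr // -subr_ge0.
have -> : (1 + c / (1 - c) * `|p| ^+ k) * (1 - c * `|p| ^+ k) - 1 =
  c * `|p| ^+ k * ((c - c * `|p| ^+ k) / (1 - c)).
  by field; rewrite lt0r_neq0.
by rewrite mulr_ge0 // divr_ge0 ?subr_ge0 // ltW.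
Qed.

(** Consecutive partial products differ by -x p^n (x; p)_n, which is geometrically small, so the
    sequence is 1 plus the partial sums of a convergent series. *)
Lemma qpoch_cvg (K : numFieldType) (x p : K) :
  geom_complete K -> `|p| < 1 -> qpoch x p @ \oo --> qpoch_inf x p.
Proof.
move=> hK p1; have [B B0 hB] := qpoch_bound hK p1 (normr_ge0 x).
suff : cvgn (qpoch x p) by [].
have h : cvgn (series (fun n => - (x * p ^+ n * qpoch x p n))).
  apply: (hK _ (B * `|x|) `|p|) => // n.
  rewrite normrN !normrM normrX mulrC -mulrA.
  by apply: ler_wpM2r; [rewrite mulr_ge0 // exprn_ge0 | exact: hB].
have -> : qpoch x p =
    fun n => 1 + series (fun n => - (x * p ^+ n * qpoch x p n)) n.
  apply/funext; elim=> [|n IHn]; first by rewrite qpoch0 seriesEnat /= big_geq // addr0.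
  by rewrite qpochS seriesSr addrA -IHn; ring.
by apply: is_cvgD => //; exact: is_cvg_cst.
Qed.

(** The reciprocals of the partial products are bounded, so the partial products stay away from
    0. *)
Lemma qpoch_inf_neq0 (K : numFieldType) (x p : K) :
  geom_complete K -> `|p| < 1 -> `|x| < 1 -> qpoch_inf x p != 0.
Proof.
move=> hK p1 x1; have [B B0 hB] := qpoch_inv_bound hK p1 (normr_ge0 x) x1.
apply/eqP => e; have := @qpoch_cvg _ x _ hK p1; rewrite e => /cvgn_epsP.
have B0' : 0 < B^-1 by rewrite invr_gt0.
move=> /(_ _ B0') [N /(_ N (leqnn N))].
rewrite sub0r normrN => h; have := hB x N (lexx _).
rewrite normfV -[leRHS]invrK lef_pV2 ?posrE ?normr_gt0 ?qpoch_neq0 //.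
by move=> /le_lt_trans /(_ h); rewrite ltxx.
Qed.

Lemma qpoch_inf_shift (K : numFieldType) (x p : K) (n : nat) :
  geom_complete K -> `|p| < 1 ->
  qpoch_inf x p = qpoch x p n * qpoch_inf (x * p ^+ n) p.
Proof.
move=> hK p1; apply: limn_eq.
rewrite -(cvg_shiftn n).
under eq_fun do rewrite addnC qpochD.
by apply: cvgMr; exact: qpoch_cvg.
Qed.

Lemma geom_le_cvg0 (K : numFieldType) (u : nat -> K) (c r : K) :
  geom_complete K -> 0 <= r -> r < 1 -> (forall n, `|u n| <= c * r ^+ n) ->
  u @ \oo --> 0.
Proof. by move=> hK r0 r1 hu; apply: cvg_series_cvg_0; exact: hK r0 r1 hu. Qed.

Lemma expr_cvg0 (K : numFieldType) (p : K) :
  geom_complete K -> `|p| < 1 -> (fun n => p ^+ n) @ \oo --> 0.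
Proof.
move=> hK p1; apply: (geom_le_cvg0 (c := 1) hK (normr_ge0 p) p1) => n.
by rewrite normrX mul1r.
Qed.

(** * The q-Gauss summation *)

(** The term of 2phi1(A, B; C; p, z) in the q-Gauss case z = C / (AB). Writing C as ABz avoids a
    division and makes C move to Cp when z moves to zp. *)
Definition gauss_term (K : numFieldType) (A B p z : K) (n : nat) : K :=
  qpoch A p n * qpoch B p n / (qpoch p p n * qpoch (A * B * z) p n) * z ^+ n.

(** One constant D serves all arguments w in the disc |w| <= |z|, in particular all the shifts z p^m
    used below. *)
Lemma gauss_term_bound (K : numFieldType) (A B p z : K) :
  geom_complete K -> `|p| < 1 -> `|A * B * z| < 1 ->
  exists2 D, 0 < D &
    forall w n, `|w| <= `|z| -> `|gauss_term A B p w n| <= D * `|w| ^+ n.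
Proof.
move=> hK p1 C1.
have [DA DA0 hA] := qpoch_bound hK p1 (normr_ge0 A).
have [DB DB0 hB] := qpoch_bound hK p1 (normr_ge0 B).
have [Dp Dp0 hp] := qpoch_inv_bound hK p1 (normr_ge0 p) p1.
have [DC DC0 hC] := qpoch_inv_bound hK p1 (normr_ge0 (A * B * z)) C1.
exists (DA * DB * (Dp * DC)) => [|w n wz]; first by rewrite !mulr_gt0.
rewrite /gauss_term normrM normrX; apply: ler_wpM2r; first exact: exprn_ge0.
rewrite invfM !normrM.
apply: ler_pM; rewrite ?mulr_ge0 //; apply: ler_pM => //.
- exact: hA.
- exact: hB.
- exact: hp.
- apply: hC; rewrite !normrM; apply: ler_wpM2l => //; exact: mulr_ge0.
Qed.

(* The contiguous relation z -> z p telescopes, with certificate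
   -(1 - p^n) u_n(z). *)
Lemma gauss_contiguous_series (K : numFieldType) (A B p z : K) (n : nat) :
  `|p| < 1 -> `|A * B * z| < 1 ->
  (1 - z) * (1 - A * B * z) * series (gauss_term A B p z) n =
  (1 - A * z) * (1 - B * z) * series (gauss_term A B p (z * p)) n
  - (1 - A * B * z) * ((1 - p ^+ n) * gauss_term A B p z n).
Proof.
move=> p1 C1; elim: n => [|n IHn].
  by rewrite !seriesEnat /= !big_geq // expr0 subrr !(mul0r, mulr0) subr0.
rewrite !seriesSr [LHS]mulrDr IHn.
have hp := qpoch_neq0 n p1 p1.
have hp' := subr1_neq0 (norm_qfactor_lt1 n p1 p1).
have hC0 := subr1_neq0 C1.
have hC := qpoch_neq0 n C1 p1.
have hC' := subr1_neq0 (norm_qfactor_lt1 n C1 p1).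
(* Expressing the shifted lower symbol through the unshifted one leaves a rational identity for
   [field]. *)
have eCp : qpoch (A * B * (z * p)) p n =
    qpoch (A * B * z) p n * (1 - A * B * z * p ^+ n) / (1 - A * B * z).
  rewrite -qpochS -add1n qpochD /qpoch big_ord1 expr0 expr1 mulr1 mulrA.
  by field.
rewrite /gauss_term eCp !qpochS exprMn !exprS.
move: hp hp' hC0 hC hC'.
move: (qpoch A p n) (qpoch B p n) (qpoch p p n) (qpoch _ p n) => a b d e.
move: (p ^+ n) (z ^+ n) => x y hp hp' hC0 hC hC'.
field.
by rewrite hp hp' hC0 hC hC'.
Qed.

Lemma gauss_cvg (K : numFieldType) (A B p z : K) :
  geom_complete K -> `|p| < 1 -> `|z| < 1 -> `|A * B * z| < 1 ->
  cvg_series (gauss_term A B p z).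
Proof.
move=> hK p1 z1 C1; have [D D0 hD] := gauss_term_bound hK p1 C1.
by apply: (hK _ D `|z|) => // n; exact: hD.
Qed.

Lemma gauss_contiguous (K : numFieldType) (A B p z : K) :
  geom_complete K -> `|p| < 1 -> `|z| < 1 -> `|A * B * z| < 1 ->
  (1 - z) * (1 - A * B * z) * sum_series (gauss_term A B p z) =
  (1 - A * z) * (1 - B * z) * sum_series (gauss_term A B p (z * p)).
Proof.
move=> hK p1 z1 C1.
have zp1 : `|z * p| < 1 by have := norm_qfactor_lt1 1 z1 p1; rewrite expr1.
have Cp1 : `|A * B * (z * p)| < 1.
  by have := norm_qfactor_lt1 1 C1 p1; rewrite expr1 mulrA.
have cz := gauss_cvg hK p1 z1 C1.
have czp := gauss_cvg hK p1 zp1 Cp1.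
have l1 : (fun n => (1 - z) * (1 - A * B * z) * series (gauss_term A B p z) n)
    @ \oo --> (1 - z) * (1 - A * B * z) * sum_series (gauss_term A B p z).
  exact: cvgMr.
rewrite -(limn_eq l1); apply: limn_eq.
under eq_fun do rewrite gauss_contiguous_series //.
rewrite -[(1 - A * z) * _ * _]subr0; apply: cvgB; first exact: cvgMr.
(* The boundary term of the telescoping vanishes in the limit, since the terms of a convergent
   series tend to 0. *)
have -> : 0 = (1 - A * B * z) * ((1 - 0) * 0) :> K by rewrite !mulr0.
apply: cvgMr; apply: cvgM; last exact: cvg_series_cvg_0.
apply: cvgB; first exact: cvg_cst.
exact: expr_cvg0.
Qed.

Lemma gauss_contiguous_iter (K : numFieldType) (A B p z : K) (m : nat) :
  geom_complete K -> `|p| < 1 -> `|z| < 1 -> `|A * B * z| < 1 ->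
  qpoch z p m * qpoch (A * B * z) p m * sum_series (gauss_term A B p z) =
  qpoch (A * z) p m * qpoch (B * z) p m
    * sum_series (gauss_term A B p (z * p ^+ m)).
Proof.
move=> hK p1 z1 C1; elim: m => [|m IHm].
  by rewrite !qpoch0 !mul1r expr0 mulr1.
have zm1 := norm_qfactor_lt1 m z1 p1.
have Cm1 : `|A * B * (z * p ^+ m)| < 1.
  by rewrite mulrA; exact: norm_qfactor_lt1.
have := gauss_contiguous hK p1 zm1 Cm1.
rewrite -(mulrA z) -exprSr => h.
rewrite !qpochS.
transitivity ((1 - z * p ^+ m) * (1 - A * B * z * p ^+ m) *
   (qpoch z p m * qpoch (A * B * z) p m * sum_series (gauss_term A B p z))).
  by ring.
rewrite IHm.
transitivity (qpoch (A * z) p m * qpoch (B * z) p m *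
   ((1 - z * p ^+ m) * (1 - A * B * (z * p ^+ m)) *
    sum_series (gauss_term A B p (z * p ^+ m)))); first by ring.
by rewrite h; ring.
Qed.

(** The argument z p^m tends to 0, so by Tannery's theorem only the term n = 0 survives. *)
Lemma gauss_cvg1 (K : numFieldType) (A B p z : K) :
  geom_complete K -> `|p| < 1 -> `|z| < 1 -> `|A * B * z| < 1 ->
  (fun m => sum_series (gauss_term A B p (z * p ^+ m))) @ \oo --> (1 : K).
Proof.
move=> hK p1 z1 C1; have [D D0 hD] := gauss_term_bound hK p1 C1.
have zm m : `|z * p ^+ m| <= `|z|.
  by rewrite normrM normrX ler_piMr // exprn_ile1 // ltW.
pose g n : K := (n == 0%N)%:R.
have [] := @tannery _ (fun m => gauss_term A B p (z * p ^+ m)) g D `|z| hK.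
- exact: normr_ge0.
- exact: z1.
- move=> m n; apply: le_trans (hD _ n (zm m)) _.
  by rewrite ler_pM2l // lerXn2r ?nnegrE.
- case=> [|n].
    suff -> : (fun m => gauss_term A B p (z * p ^+ m) 0) = fun=> g 0%N.
      exact: cvg_cst.
    by apply/funext => m; rewrite /gauss_term /g !qpoch0 expr0 !mulr1 divr1.
  (* For exponent n + 1 >= 1, |z p^m|^(n+1) <= |p|^m. *)
  apply: (geom_le_cvg0 (c := D) hK (normr_ge0 p) p1) => m.
  apply: le_trans (hD _ n.+1 (zm m)) _; rewrite ler_pM2l //.
  rewrite normrM normrX exprMn -exprM mulnS exprD.
  rewrite -[leRHS]mul1r; apply: ler_pM; rewrite ?mulr_ge0 ?exprn_ge0 //.
    by rewrite exprn_ile1 // ltW.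
  by rewrite ler_piMr ?exprn_ge0 // exprn_ile1 // ltW.
move=> _; rewrite (_ : sum_series g = 1) //.
apply: limn_eq; apply/cvgn_epsP => e e0; exists 1%N => -[//|n] _.
rewrite seriesEnat /= big_nat_recl // big1 => [|i _]; last by [].
by rewrite /g /= addr0 subrr normr0.
Qed.

(** Let m tend to infinity in [gauss_contiguous_iter]: the finite symbols become infinite products
    and the remaining series tends to 1. *)
Lemma q_gauss (K : numFieldType) (A B p z : K) :
  geom_complete K -> `|p| < 1 -> `|z| < 1 -> `|A * B * z| < 1 ->
  sum_series (gauss_term A B p z) =
  qpoch_inf (A * z) p * qpoch_inf (B * z) p /
    (qpoch_inf z p * qpoch_inf (A * B * z) p).
Proof.
move=> hK p1 z1 C1.
have hz := qpoch_inf_neq0 hK p1 z1.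
have hC := qpoch_inf_neq0 hK p1 C1.
suff h : qpoch_inf z p * qpoch_inf (A * B * z) p *
    sum_series (gauss_term A B p z) =
    qpoch_inf (A * z) p * qpoch_inf (B * z) p * 1.
  by rewrite mulr1 in h; rewrite -h; field; rewrite hz hC.
have l1 : (fun m => qpoch z p m * qpoch (A * B * z) p m *
    sum_series (gauss_term A B p z)) @ \oo -->
    qpoch_inf z p * qpoch_inf (A * B * z) p * sum_series (gauss_term A B p z).
  by apply: cvgMl; apply: cvgM; exact: qpoch_cvg.
rewrite -(limn_eq l1); apply: limn_eq.
under eq_fun do rewrite gauss_contiguous_iter //.
apply: cvgM; last exact: gauss_cvg1.
by apply: cvgM; exact: qpoch_cvg.
Qed.

(** * The Bailey pair relative to q^2 *)

Lemma sum_triangle (V : nmodType) (F : nat -> nat -> V) (N : nat) :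
  \sum_(0 <= n < N) \sum_(0 <= j < n.+1) F n j =
  \sum_(0 <= j < N) \sum_(j <= n < N) F n j.
Proof.
elim: N => [|N IHN]; first by rewrite !big_geq.
rewrite big_nat_recr //= IHN.
rewrite [RHS]big_nat_recr //= big_nat1.
rewrite [in LHS]big_nat_recr //= addrA; congr (_ + _).
rewrite -big_split /=; apply: eq_big_nat => j /andP [_ jN].
by rewrite [RHS]big_nat_recr // ltnW.
Qed.

(* The number of integers of absolute value j. *)
Definition sym_weight (K : numFieldType) (j : nat) : K := (j != 0%N).+1%:R.

(** Folding about the centre n: doubling makes the formula uniform, as the central term is counted
    twice with weight 1 and each pair n + j, n - j once with weight 2. *)
Lemma sum_sym (K : numFieldType) (F : nat -> K) (n : nat) :
  2 * \sum_(0 <= i < n.*2.+1) F i =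
  \sum_(0 <= j < n.+1) sym_weight K j * (F (n + j)%N + F (n - j)%N).
Proof.
elim: n F => [|n IHn] F.
  by rewrite !big_nat1 /sym_weight /= mul1r mulr_natl mulr2n.
rewrite doubleS big_nat_recl // big_nat_recr //= [RHS]big_nat_recr //=.
have -> : \sum_(0 <= j < n.+1) sym_weight K j *
      (F (n.+1 + j)%N + F (n.+1 - j)%N) =
    \sum_(0 <= j < n.+1) sym_weight K j *
      (F (n + j).+1%N + F (n - j).+1%N).
  apply: eq_big_nat => j /andP [_ jn].
  by rewrite addSn subSn.
rewrite -(IHn (fun i => F i.+1)) subnn addnn doubleS /sym_weight /=.
by ring.
Qed.

(* Replacing k by M - k turns q^M h_M into the sum h_M with an extra factor
   q^(2(M-k)), whence (1 - q^M) h_M = h_(M-1). *)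
Lemma sum_qpoch_sq (K : numFieldType) (q : K) (M : nat) :
  `|q| < 1 ->
  \sum_(0 <= k < M.+1)
    q ^+ k / (qpoch (q ^+ 2) (q ^+ 2) k * qpoch (q ^+ 2) (q ^+ 2) (M - k)) =
  (qpoch q q M)^-1.
Proof.
move=> q1; set p := q ^+ 2.
have p1 : `|p| < 1 by rewrite /p normrX expr_lt1.
pose A k := (qpoch p p k)^-1.
have AS m : A m.+1 * (1 - p ^+ m.+1) = A m.
  rewrite /A qpochS exprS; field.
  rewrite (subr1_neq0 (norm_qfactor_lt1 m p1 p1)) /=.
  by rewrite qpoch_neq0.
pose h M := \sum_(0 <= k < M.+1) q ^+ k * (A k * A (M - k)%N).
rewrite (eq_big_nat _ _ (F2 := fun k => q ^+ k * (A k * A (M - k)%N))); last first.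
  by move=> k _; rewrite invfM.
rewrite -/(h M).
have hS m : (1 - q ^+ m.+1) * h m.+1 = h m.
  rewrite mulrBl mul1r {2}/h big_nat_rev /= mulr_sumr /h -sumrB.
  (* The top term k = m + 1 cancels against its reversed copy, which leaves the range of h_m. *)
  rewrite big_nat_recr //= [X in _ + X](_ : _ = 0) ?addr0; last first.
    by rewrite add0n !subnn subn0; ring.
  apply: eq_big_nat => k /andP [_ km].
  rewrite add0n subSS subKn 1?ltnW // subSn // -(AS (m - k)%N).
  have -> : q ^+ m.+1 * (q ^+ (m - k).+1 * (A (m - k).+1 * A k)) =
            q ^+ k * (A k * (p ^+ (m - k).+1 * A (m - k).+1)).
    rewrite /p -exprM mulrA -exprD.
    rewrite (_ : (m.+1 + (m - k).+1 = k + 2 * (m - k).+1)%N) ?exprD; last by lia.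
    by ring.
  by ring.
elim: M => [|M IHM].
  by rewrite /h big_nat1 /A !qpoch0 expr0 invr1 !mulr1.
have hq : 1 - q ^+ M.+1 != 0.
  by have := subr1_neq0 (norm_qfactor_lt1 M q1 q1); rewrite -exprS.
apply: (mulfI hq); rewrite hS IHM qpochS -exprS; field.
by rewrite hq /= qpoch_neq0.
Qed.

(** The sum over |j| <= n is folded onto j >= 0 by [sym_weight], so that summing over n gives a
    triangular sum over natural numbers. *)
Definition bailey_alpha (K : numFieldType) (q : K) (n : nat) : K :=
  (1 - q ^+ (4 * n + 2)) * (q ^+ (n ^ 2) / q ^+ n) *
    \sum_(0 <= j < n.+1) sym_weight K j / q ^+ (j ^ 2).

Lemma addr1_expr_neq0 (K : numFieldType) (p : K) (n : nat) :
  `|p| < 1 -> 1 + p ^+ n != 0.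
Proof.
case: n => [|n] p1; first by rewrite expr0 -[1 + 1]/(2%:R) pnatr_eq0.
rewrite -[p ^+ n.+1]opprK; apply: subr1_neq0.
by rewrite normrN normrX expr_lt1.
Qed.

(* The summand is T_n - T_(n+1), where T_m is the right-hand side. *)
Lemma bailey_tail (K : numFieldType) (q : K) (N m : nat) :
  q != 0 -> `|q| < 1 -> (m <= N)%N ->
  \sum_(m <= n < N.+1) (1 - q ^+ (4 * n + 2)) * (q ^+ (n ^ 2) / q ^+ n) /
    (qpoch (q ^+ 2) (q ^+ 2) (N - n) * qpoch (q ^+ 2) (q ^+ 2) (N + n).+1) =
  (1 + q ^+ (2 * m)) * (q ^+ (m ^ 2) / q ^+ m) /
    ((1 + q ^+ (2 * N)) * (qpoch (q ^+ 2) (q ^+ 2) (N - m) *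
      qpoch (q ^+ 2) (q ^+ 2) (N + m))).
Proof.
move=> q0 q1 mN; set p := q ^+ 2.
have p1 : `|p| < 1 by rewrite /p normrX expr_lt1.
have hp n := qpoch_neq0 n p1 p1.
have hN : 1 + q ^+ (2 * N) != 0 by rewrite exprM; exact: addr1_expr_neq0.
(* The sign is the one required by [telescope_sumr]. The value 0 beyond N replaces a formula that
   truncated subtraction in [N - n] would falsify. *)
pose T n := if (n <= N)%N then - ((1 + q ^+ (2 * n)) * (q ^+ (n ^ 2) / q ^+ n) /
    ((1 + q ^+ (2 * N)) * (qpoch p p (N - n) * qpoch p p (N + n)))) else 0.
transitivity (T N.+1 - T m); last by rewrite /T ltnn mN sub0r opprK.
rewrite -telescope_sumr; last by rewrite ltnW.
apply: eq_big_nat => n /andP [_]; rewrite ltnS => nN.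
have hf : 1 - p * p ^+ (N + n) != 0 by exact/subr1_neq0/norm_qfactor_lt1.
have e4 : q ^+ (4 * n + 2) = (q ^+ n) ^+ 4 * q ^+ 2 by rewrite exprD mulnC exprM.
have ex : p ^+ (N + n) = (q ^+ N) ^+ 2 * (q ^+ n) ^+ 2.
  by rewrite exprD /p -!exprM ![(2 * _)%N]mulnC.
have q2 k : q ^+ (2 * k) = (q ^+ k) ^+ 2 by rewrite mulnC exprM.
move: nN; rewrite leq_eqVlt => /orP [/eqP nN|nN].
  subst n; rewrite /T ltnn leqnn subnn qpoch0 mul1r qpochS.
  move: hf hN (hp (N + N)%N); rewrite e4 ex q2 /p.
  have := expf_neq0 N q0.
  move: (q ^+ N) (qpoch _ _ _) (q ^+ (N ^ 2)) => x y z x0 hf hN y0.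
  field.
  rewrite y0 hN x0 /=; apply: contra_neq hf => <-; ring.
rewrite /T nN ltnW // qpochS.
have -> : (N - n = (N - n.+1).+1)%N by lia.
rewrite (addnS N n) !qpochS.
(* With N = d + n + 1, every power of q becomes a monomial in q, q^n, q^d and q^(n^2), and [field]
   can decide the step. *)
set d := (N - n.+1)%N.
have hd : 1 - p * p ^+ d != 0 by exact/subr1_neq0/norm_qfactor_lt1.
have ed : q ^+ N = q ^+ d * q ^+ n * q.
  by rewrite -exprD -exprSr; congr (_ ^+ _); rewrite /d; lia.
have ed2 : p ^+ d = (q ^+ d) ^+ 2 by rewrite /p -!exprM mulnC.
have en : q ^+ (n.+1 ^ 2) = q ^+ (n ^ 2) * (q ^+ n) ^+ 2 * q.
  by rewrite -exprM -exprD -exprSr; congr (_ ^+ _); lia.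
have en1 : q ^+ n.+1 = q ^+ n * q by rewrite exprSr.
have hd0 := hp d; have hs0 := hp (N + n)%N.
move: hf hN hd hd0 hs0; rewrite e4 !q2 en en1 ex ed2 ed /p.
have := expf_neq0 n q0.
move: (q ^+ n) (q ^+ d) (qpoch _ _ d) (qpoch _ _ (N + n)) (q ^+ (n ^ 2)).
move=> x w y z u x0 hf hN hd y0 z0.
field.
rewrite z0 y0 hN x0 q0 /= andbT; apply/andP; split.
  by apply: contra_neq hd => <-; ring.
by apply: contra_neq hf => <-; ring.
Qed.

(** The right-hand side is beta_N. Once j is made the outer index, [bailey_tail] evaluates the sum
    over n and its q^(j^2) cancels the q^(-j^2) of alpha_n. The rest is a symmetric sum over i = N +
    j and i = N - j, given by [sum_qpoch_sq] at M = 2N. *)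
Lemma bailey_pair (K : numFieldType) (q : K) (N : nat) :
  q != 0 -> `|q| < 1 ->
  \sum_(0 <= n < N.+1) bailey_alpha q n /
    (qpoch (q ^+ 2) (q ^+ 2) (N - n) * qpoch (q ^+ 2) (q ^+ 2) (N + n).+1) =
  2 / (q ^+ N * (1 + q ^+ (2 * N)) * qpoch q q (2 * N)).
Proof.
move=> q0 q1.
have p1 : `|q ^+ 2| < 1 by rewrite normrX expr_lt1.
have hp n := qpoch_neq0 n p1 p1.
have hN : 1 + q ^+ (2 * N) != 0 by rewrite exprM; exact: addr1_expr_neq0.
pose t n := (1 - q ^+ (4 * n + 2)) * (q ^+ (n ^ 2) / q ^+ n) /
    (qpoch (q ^+ 2) (q ^+ 2) (N - n) * qpoch (q ^+ 2) (q ^+ 2) (N + n).+1).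
transitivity (\sum_(0 <= n < N.+1) \sum_(0 <= j < n.+1)
    sym_weight K j / q ^+ (j ^ 2) * t n).
  apply: eq_big_nat => n _; rewrite -mulr_suml /t /bailey_alpha.
  by ring.
rewrite sum_triangle.
(* [F (N + j)] and [F (N - j)] share a denominator and have numerators q^j and q^(-j), whose sum is
   (1 + q^(2j)) / q^j. *)
pose F i := q ^+ i / q ^+ N / (qpoch (q ^+ 2) (q ^+ 2) i *
   qpoch (q ^+ 2) (q ^+ 2) (2 * N - i)).
transitivity (\sum_(0 <= j < N.+1) (1 + q ^+ (2 * N))^-1 *
    (sym_weight K j * (F (N + j)%N + F (N - j)%N))).
  apply: eq_big_nat => j /andP [_]; rewrite ltnS => jN.
  rewrite -mulr_sumr bailey_tail // /F.
  rewrite (_ : (2 * N - (N + j) = N - j)%N); last by lia.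
  rewrite (_ : (2 * N - (N - j) = N + j)%N); last by lia.
  have -> : q ^+ N = q ^+ (N - j) * q ^+ j by rewrite -exprD subnK.
  have -> : q ^+ (N + j) = q ^+ (N - j) * q ^+ j * q ^+ j.
    by rewrite -!exprD; congr (_ ^+ _); lia.
  rewrite [q ^+ (2 * j)]exprM exprAC.
  have := (expf_neq0 j q0, expf_neq0 (N - j) q0, expf_neq0 (j ^ 2) q0).
  move: hN (hp (N - j)%N) (hp (N + j)%N).
  move: (qpoch _ _ (N - j)) (qpoch _ _ (N + j)) (q ^+ j) (q ^+ (j ^ 2)).
  move: (q ^+ (N - j)) (sym_weight K j) (q ^+ (2 * N)).
  move=> x s y u v w z y0 u0 v0 [[w0 x0] z0].
  field.
  by rewrite x0 y0 u0 v0 w0 z0.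
rewrite -mulr_sumr -sum_sym -mul2n.
have -> : \sum_(0 <= i < (2 * N).+1) F i = (qpoch q q (2 * N))^-1 / q ^+ N.
  rewrite -(sum_qpoch_sq _ q1) mulr_suml; apply: eq_big_nat => k _.
  by rewrite /F; ring.
by rewrite !invfM; ring.
Qed.

(** * The 3phi2 term through beta_n, and the size of alpha_n *)

(** Both sides are (-1; p)_(n+1), with the last or the first factor split off. *)
Lemma qpoch_opp1 (K : numFieldType) (p : K) (n : nat) :
  qpoch (-1) p n * (1 + p ^+ n) = 2 * qpoch (- p) p n.
Proof.
have -> : 1 + p ^+ n = 1 - (-1) * p ^+ n by ring.
rewrite -qpochS -add1n qpochD expr1 mulN1r; congr (_ * _).
by rewrite /qpoch big_ord1 expr0; ring.
Qed.

Lemma qpoch_double (K : numFieldType) (q : K) (n : nat) :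
  qpoch q q (2 * n) = qpoch q (q ^+ 2) n * qpoch (q ^+ 2) (q ^+ 2) n.
Proof.
elim: n => [|n IHn]; first by rewrite muln0 !qpoch0 mulr1.
rewrite (_ : 2 * n.+1 = (2 * n).+2)%N; last by lia.
rewrite !qpochS IHn -!exprM.
have -> : q ^+ (2 * n).+1 = q * q ^+ (2 * n) by rewrite exprS.
by ring.
Qed.

(** The last factor is beta_n as evaluated by [bailey_pair]: the parameters -1, q, -q^2 and the 1/q
    in the argument produce exactly it. *)
Lemma phi32_termE (K : numFieldType) (A B q z : K) (n : nat) :
  q != 0 -> `|q| < 1 ->
  phi32_term A B (-1) q (- q ^+ 2) (q ^+ 2) (z / q) n =
  qpoch A (q ^+ 2) n * qpoch B (q ^+ 2) n * z ^+ n *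
    (2 / (q ^+ n * (1 + q ^+ (2 * n)) * qpoch q q (2 * n))).
Proof.
move=> q0 q1; set p := q ^+ 2.
have p1 : `|p| < 1 by rewrite /p normrX expr_lt1.
have hN : 1 + q ^+ (2 * n) != 0 by rewrite exprM; exact: addr1_expr_neq0.
have e : qpoch (-1) p n = 2 * qpoch (- p) p n / (1 + q ^+ (2 * n)).
  by rewrite -qpoch_opp1 exprM; field; rewrite -exprM.
rewrite /phi32_term /qpochs !big_cons !big_nil e qpoch_double expr_div_n.
have h1 := qpoch_neq0 n p1 p1.
have h2 := qpoch_neq0 n q1 p1.
have h3 : qpoch (- p) p n != 0 by apply: qpoch_neq0 => //; rewrite normrN.
have h4 := expf_neq0 n q0.
rewrite -/p; move: hN h1 h2 h3 h4.
move: (q ^+ (2 * n)) (qpoch p p n) (qpoch q p n) (qpoch (- p) p n) (q ^+ n).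
move=> x y w u v hN y0 w0 u0 v0.
field.
by rewrite y0 w0 u0 v0 hN.
Qed.

Lemma sum_sym_range (K : numFieldType) (q : K) (n : nat) :
  q != 0 ->
  \sum_(j <- sym_range n) q ^ (- (j ^+ 2)) =
  \sum_(0 <= j < n.+1) sym_weight K j / q ^+ (j ^ 2).
Proof.
move=> q0; have two0 : (2 : K) != 0 by rewrite pnatr_eq0.
apply: (mulfI two0); rewrite /sym_range big_map.
rewrite -[iota _ _]/(index_iota 0 n.*2.+1) sum_sym mulr_sumr.
apply: eq_big_nat => j /andP [_]; rewrite ltnS => jn.
have -> : (n + j)%N%:Z - n%:Z = j%:Z by lia.
have -> : ((n - j)%N%:Z - n%:Z) ^+ 2 = j%:Z ^+ 2.
  by rewrite (_ : _ - _ = - j%:Z) ?sqrrN //; lia.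
rewrite -rmorphXn /= exprnN /=.
by ring.
Qed.

(** Since n^2 - j^2 >= n - j, multiplying the sum by q^(n^2) leaves at most a geometric sum with
    weights 2; only the factor q^(-n) can grow. *)
Lemma bailey_alpha_bound (K : numFieldType) (q : K) (n : nat) :
  q != 0 -> `|q| < 1 ->
  `|bailey_alpha q n| <= 4 / (1 - `|q|) / `|q| ^+ n.
Proof.
move=> q0 q1; have q1' : 0 < 1 - `|q| by rewrite subr_gt0.
have qn0 : 0 < `|q| ^+ n by rewrite exprn_gt0 // normr_gt0.
have h1 : `|1 - q ^+ (4 * n + 2)| <= 2.
  apply: le_trans (ler_normB _ _) _.
  by rewrite normr1 -[2]/(1 + 1) lerD2l normrX exprn_ile1 // ltW.
have h2 : `|q ^+ (n ^ 2) * \sum_(0 <= j < n.+1) sym_weight K j / q ^+ (j ^ 2)|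
    <= 2 / (1 - `|q|).
  rewrite mulr_sumr; apply: le_trans (ler_norm_sum _ _ _) _.
  have := sum_geom_le 0 n.+1 (ler0n K 2) (normr_ge0 q) q1.
  rewrite expr0 mulr1; apply: le_trans.
  rewrite [leRHS]big_nat_rev /= !big_nat; apply: ler_sum => j /andP [_ jn].
  have jn2 : (j ^ 2 <= n ^ 2)%N by rewrite leq_sqr.
  have -> : q ^+ (n ^ 2) * (sym_weight K j / q ^+ (j ^ 2)) =
      sym_weight K j * q ^+ (n ^ 2 - j ^ 2).
    rewrite -{1}(subnK jn2) exprD; field.
    exact: expf_neq0.
  rewrite normrM normrX; apply: ler_pM; rewrite ?exprn_ge0 //.
    by rewrite /sym_weight normr_nat ler_nat; case: (j != 0%N).
  by apply: ler_wiXn2l => //; [exact: ltW | nia].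
rewrite /bailey_alpha.
have -> : (1 - q ^+ (4 * n + 2)) * (q ^+ (n ^ 2) / q ^+ n) *
    \sum_(0 <= j < n.+1) sym_weight K j / q ^+ (j ^ 2) =
  (1 - q ^+ (4 * n + 2)) *
    (q ^+ (n ^ 2) * \sum_(0 <= j < n.+1) sym_weight K j / q ^+ (j ^ 2)) /
    q ^+ n by ring.
rewrite normrM normfV normrX ler_pM2r ?invr_gt0 // normrM.
have -> : 4 / (1 - `|q|) = 2 * (2 / (1 - `|q|)) by ring.
exact: ler_pM.
Qed.

(** * Exchange of the sums and evaluation of the inner ones *)

Section BaileySum.
Variables (K : numFieldType) (q a b : K).
Hypotheses (hK : geom_complete K).
Hypotheses (q_neq0 : q != 0) (a_neq0 : a != 0) (b_neq0 : b != 0).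
Hypotheses (q_lt1 : `|q| < 1) (abq_lt1 : `|a * b / q| < 1).
Hypotheses (aq_lt1 : `|a * q ^+ 2| < 1) (bq_lt1 : `|b * q ^+ 2| < 1).

Let p := q ^+ 2.
Let p_lt1 : `|p| < 1. Proof. by rewrite /p normrX expr_lt1. Qed.
Let ab_lt1 : `|a * b| < 1.
Proof.
have -> : a * b = a * b / q * q by field.
by rewrite normrM mulr_ilt1.
Qed.
Let pn_neq0 n : qpoch p p n != 0. Proof. exact: qpoch_neq0. Qed.

(** This is the lower parameter of the inner q-Gauss series; its symbols continue (p; p)_(2n+1). *)
Let gauss_arg n :
  q ^+ 2 / a * p ^+ n * (q ^+ 2 / b * p ^+ n) * (a * b) = p * p ^+ (2 * n).+1.
Proof.
rewrite (exprSr p) mul2n -addnn exprD /p.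
by field; rewrite a_neq0 b_neq0.
Qed.

(** The coefficient of alpha_n in the N-th term of the 3phi2 series, for n <= N. *)
Definition bailey_weight (n N : nat) : K :=
  qpoch (q ^+ 2 / a) p N * qpoch (q ^+ 2 / b) p N * (a * b) ^+ N /
    (qpoch p p (N - n) * qpoch p p (N + n).+1).

(** The exchange is made on partial sums, where it is finite; a single limit in M then remains for
    Tannery's theorem. *)
Lemma phi32_series (M : nat) :
  series (phi32_term (q ^+ 2 / a) (q ^+ 2 / b) (-1) q (- q ^+ 2)
            (q ^+ 2) (a * b / q)) M =
  \sum_(0 <= n < M) bailey_alpha q n * \sum_(n <= N < M) bailey_weight n N.
Proof.
under [RHS]eq_bigr do rewrite mulr_sumr.
rewrite seriesEnat /=.
rewrite -(sum_triangle (fun N n => bailey_alpha q n * bailey_weight n N)).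
apply: eq_bigr => N _; rewrite phi32_termE // -bailey_pair // mulr_sumr.
by apply: eq_bigr => n _; rewrite /bailey_weight; ring.
Qed.

Lemma bailey_weight_series (n M : nat) :
  \sum_(n <= N < M) bailey_weight n N =
  qpoch (q ^+ 2 / a) p n * qpoch (q ^+ 2 / b) p n * (a * b) ^+ n /
    qpoch p p (2 * n).+1 *
  series (gauss_term (q ^+ 2 / a * p ^+ n) (q ^+ 2 / b * p ^+ n) p (a * b))
    (M - n)%N.
Proof.
rewrite -{1}[n]/(0 + n)%N big_addn seriesEnat /= mulr_sumr.
apply: eq_bigr => i _; rewrite /bailey_weight addnK /gauss_term.
have -> : ((i + n + n).+1 = (2 * n).+1 + i)%N by lia.
rewrite [(i + n)%N]addnC !qpochD exprD.
rewrite gauss_arg.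
by rewrite !invfM; ring.
Qed.

Definition hecke_term (n : nat) : K :=
  bailey_alpha q n *
  (qpoch (q ^+ 2 / a) p n * qpoch (q ^+ 2 / b) p n /
   (qpoch (a * p) p n * qpoch (b * p) p n)) * (a * b) ^+ n.

(** The reciprocal of the infinite product in front of the 3phi2. *)
Definition bailey_const : K :=
  qpoch_inf (a * p) p * qpoch_inf (b * p) p /
    (qpoch_inf p p * qpoch_inf (a * b) p).

Lemma bailey_weight_cvg (n : nat) :
  (fun M => bailey_alpha q n * \sum_(n <= N < M) bailey_weight n N) @ \oo
    --> bailey_const * hecke_term n.
Proof.
have C1 : `|q ^+ 2 / a * p ^+ n * (q ^+ 2 / b * p ^+ n) * (a * b)| < 1.
  by rewrite gauss_arg; exact: norm_qfactor_lt1.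
have l : bailey_const * hecke_term n = bailey_alpha q n *
  (qpoch (q ^+ 2 / a) p n * qpoch (q ^+ 2 / b) p n * (a * b) ^+ n /
    qpoch p p (2 * n).+1 *
   sum_series (gauss_term (q ^+ 2 / a * p ^+ n) (q ^+ 2 / b * p ^+ n) p (a * b))).
  rewrite q_gauss // gauss_arg /bailey_const /hecke_term.
  have -> : q ^+ 2 / a * p ^+ n * (a * b) = b * p * p ^+ n by rewrite /p; field.
  have -> : q ^+ 2 / b * p ^+ n * (a * b) = a * p * p ^+ n by rewrite /p; field.
  (* Splitting the infinite products at n and 2n + 1 turns the q-Gauss value into a constant times
     finite symbols, and (p; p)_(2n+1) cancels. *)
  rewrite (qpoch_inf_shift (a * p) n hK p_lt1).
  rewrite (qpoch_inf_shift (b * p) n hK p_lt1).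
  rewrite (qpoch_inf_shift (p) (2 * n).+1 hK p_lt1).
  have := (qpoch_neq0 n aq_lt1 p_lt1, qpoch_neq0 n bq_lt1 p_lt1,
    pn_neq0 (2 * n).+1, qpoch_inf_neq0 hK p_lt1 ab_lt1,
    qpoch_inf_neq0 hK p_lt1 (norm_qfactor_lt1 (2 * n).+1 p_lt1 p_lt1)).
  rewrite -/p.
  move: (qpoch (a * p) p n) (qpoch (b * p) p n) (qpoch p p (2 * n).+1).
  move: (qpoch_inf (a * b) p) (qpoch_inf (p * _) p).
  move=> x y z u v [[[[z0 u0] v0] x0] y0].
  field.
  by rewrite x0 y0 z0 u0 v0.
rewrite l; apply: cvgMr.
under eq_fun do rewrite bailey_weight_series.
apply: cvgMr; rewrite -(cvg_shiftn n).
under eq_fun do rewrite addnK.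
exact: gauss_cvg.
Qed.

(** alpha_n is O(|q|^(-n)) and the inner sum from n on is O(|ab|^n), uniformly in M. The product is
    the geometric majorant of ratio |ab/q| for Tannery's theorem. *)
Lemma bailey_weight_bound :
  exists c, forall M n,
    `|bailey_alpha q n * \sum_(n <= N < M) bailey_weight n N| <=
    c * `|a * b / q| ^+ n.
Proof.
have [Da Da0 ha] := qpoch_bound hK p_lt1 (normr_ge0 (q ^+ 2 / a)).
have [Db Db0 hb] := qpoch_bound hK p_lt1 (normr_ge0 (q ^+ 2 / b)).
have [Dp Dp0 hp] := qpoch_inv_bound hK p_lt1 (normr_ge0 p) p_lt1.
set D := Da * Db * (Dp * Dp).
have D0 : 0 <= D by rewrite !mulr_ge0 // ltW.
have hw n N : `|bailey_weight n N| <= D * `|a * b| ^+ N.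
  rewrite /bailey_weight mulrAC normrM normrX.
  apply: ler_wpM2r; first exact: exprn_ge0.
  rewrite invfM !normrM.
  apply: ler_pM; rewrite ?mulr_ge0 //; apply: ler_pM => //.
  - exact: ha.
  - exact: hb.
  - exact: hp.
  - exact: hp.
exists (4 / (1 - `|q|) * (D / (1 - `|a * b|))) => M n.
have -> : 4 / (1 - `|q|) * (D / (1 - `|a * b|)) * `|a * b / q| ^+ n =
    (4 / (1 - `|q|) / `|q| ^+ n) * (D / (1 - `|a * b|) * `|a * b| ^+ n).
  rewrite [`|_ / q|]normrM normfV expr_div_n; field.
  by rewrite expf_neq0 ?normr_eq0 // !subr1_neq0 // normr_id.
rewrite normrM; apply: ler_pM => //; first exact: bailey_alpha_bound.
apply: le_trans (ler_norm_sum _ _ _) _.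
apply: le_trans (sum_geom_le n M D0 (normr_ge0 _) ab_lt1).
by apply: ler_sum => N _.
Qed.

Lemma bailey_sum :
  [/\ cvg_series (phi32_term (q ^+ 2 / a) (q ^+ 2 / b) (-1) q (- q ^+ 2)
                    (q ^+ 2) (a * b / q)),
      cvg_series hecke_term &
      phi32 (q ^+ 2 / a) (q ^+ 2 / b) (-1) q (- q ^+ 2) (q ^+ 2) (a * b / q) =
      bailey_const * sum_series hecke_term].
Proof.
have [c hc] := bailey_weight_bound.
pose f M n := bailey_alpha q n * \sum_(n <= N < M) bailey_weight n N.
have [cg lg] := tannery (f := f) hK (normr_ge0 _) abq_lt1 hc bailey_weight_cvg.
(* For n >= M the inner sum is empty, so the infinite sum over n is the finite one of
   [phi32_series]. *)
have fE M : sum_series (f M) = series (phi32_term (q ^+ 2 / a) (q ^+ 2 / b)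
    (-1) q (- q ^+ 2) (q ^+ 2) (a * b / q)) M.
  rewrite phi32_series; apply: limn_eq; apply/cvgn_epsP => e e0.
  exists M => n Mn; have z0 : \sum_(M <= k < n) f M k = 0.
    rewrite big_nat big1 // => k /andP [Mk _].
    by rewrite /f big_geq // mulr0.
  by rewrite seriesEnat /= [X in _ - X](big_cat_nat (n := M)) //= z0 addr0 subrr normr0.
(* Tannery's theorem gives convergence for the multiples by [bailey_const]; a nonzero constant can
   be divided out. *)
have C0 : bailey_const != 0.
  by rewrite /bailey_const mulf_neq0 ?invr_eq0 ?mulf_neq0 ?qpoch_inf_neq0.
have hE : hecke_term = fun n => bailey_const^-1 * (bailey_const * hecke_term n).
  by apply/funext => n; rewrite mulKf.
move: lg; under eq_fun do rewrite fE.
move=> lg.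
have lh : series hecke_term @ \oo -->
    bailey_const^-1 * sum_series (fun n => bailey_const * hecke_term n).
  rewrite {1}hE.
  have -> : series (fun n => bailey_const^-1 * (bailey_const * hecke_term n)) =
      fun n => bailey_const^-1 * series (fun n => bailey_const * hecke_term n) n.
    by apply/funext => n; rewrite !seriesEnat /= mulr_sumr.
  exact: cvgMr.
split; first by apply/cvg_ex; eexists; exact: lg.
  by apply/cvg_ex; eexists; exact: lh.
by rewrite [sum_series hecke_term](limn_eq lh) mulVKf //; exact: limn_eq.
Qed.

Lemma hecke_termE (n : nat) :
  hecke_term n =
  \sum_(j <- sym_range n)
      (1 - q ^+ (4 * n + 2)) *
      (qpochs [:: q ^+ 2 / a; q ^+ 2 / b] (q ^+ 2) n /
       qpochs [:: a * q ^+ 2; b * q ^+ 2] (q ^+ 2) n) *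
      (a * b) ^+ n * q ^ (n%:Z ^+ 2 - n%:Z - j ^+ 2).
Proof.
have expE (j : int) : q ^ (n%:Z ^+ 2 - n%:Z - j ^+ 2) =
    q ^+ (n ^ 2) / q ^+ n * q ^ (- (j ^+ 2)).
  by rewrite expfzDr // expfzDr // -rmorphXn /= -exprnP -exprnN.
rewrite -mulr_sumr; under eq_bigr do rewrite expE.
rewrite -mulr_sumr sum_sym_range // /hecke_term /bailey_alpha.
by rewrite /qpochs !big_cons !big_nil !mulr1; ring.
Qed.

Lemma qpochs_inf_phi32 :
  qpochs_inf [:: q ^+ 2; a * b] p / qpochs_inf [:: a * q ^+ 2; b * q ^+ 2] p *
    phi32 (q ^+ 2 / a) (q ^+ 2 / b) (-1) q (- q ^+ 2) (q ^+ 2) (a * b / q) =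
  sum_series hecke_term.
Proof.
have [_ _ ->] := bailey_sum.
rewrite /bailey_const /qpochs_inf !big_cons !big_nil !mulr1 mulrA.
have ha := qpoch_inf_neq0 hK p_lt1 aq_lt1.
have hb := qpoch_inf_neq0 hK p_lt1 bq_lt1.
have hp := qpoch_inf_neq0 hK p_lt1 p_lt1.
have hab := qpoch_inf_neq0 hK p_lt1 ab_lt1.
by rewrite -[RHS]mul1r; congr (_ * _); field; rewrite ha hb hp hab.
Qed.

End BaileySum.

(** * Specialization to the complex numbers *)

(** The order of [K] is only partial and [Num.max] is a test on [x < y]; for real arguments failure
    of the test does give [y <= x]. *)
Lemma max_lt_real (K : numFieldType) (x y c : K) :
  x \is Num.real -> y \is Num.real -> Num.max x y < c -> x < c /\ y < c.
Proof.
move=> xr yr; rewrite /Order.max; case: ifP => xy h.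
  by split=> //; exact: lt_trans h.
by split=> //; apply: le_lt_trans h; rewrite real_leNgt ?xy.
Qed.

Theorem theorem3p4 (R : realType) (q a b : R[i])
    (q_neq0 : q != 0) (a_neq0 : a != 0) (b_neq0 : b != 0)
    (q_lt1 : `|q| < 1)
    (max_lt1 : Num.max (Num.max `|a * b / q| `|a * q ^+ 2|) `|b * q ^+ 2| < 1) :
  let rhs_term (n : nat) : R[i] :=
    \sum_(j <- sym_range n)
      (1 - q ^+ (4 * n + 2)) *
      (qpochs [:: q ^+ 2 / a; q ^+ 2 / b] (q ^+ 2) n /
       qpochs [:: a * q ^+ 2; b * q ^+ 2] (q ^+ 2) n) *
      (a * b) ^+ n * q ^ (n%:Z ^+ 2 - n%:Z - j ^+ 2) in
  [/\ cvg_series (phi32_term (q ^+ 2 / a) (q ^+ 2 / b) (-1) q (- q ^+ 2)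
                    (q ^+ 2) (a * b / q)),
      cvg_series rhs_term &
      qpochs_inf [:: q ^+ 2; a * b] (q ^+ 2) /
        qpochs_inf [:: a * q ^+ 2; b * q ^+ 2] (q ^+ 2) *
      phi32 (q ^+ 2 / a) (q ^+ 2 / b) (-1) q (- q ^+ 2)
        (q ^+ 2) (a * b / q)
      = sum_series rhs_term].
Proof.
have hK := @complex_geom_complete R.
have mr : Num.max `|a * b / q| `|a * q ^+ 2| \is Num.real.
  by rewrite /Order.max; case: ifP; rewrite normr_real.
have [m1 b1] := max_lt_real mr (normr_real _) max_lt1.
have [ab1 a1] := max_lt_real (normr_real _) (normr_real _) m1.
move=> rhs_term.
have -> : rhs_term = hecke_term q a b.
  by apply/funext => n; rewrite hecke_termE.
have [cu ch _] := bailey_sum hK q_neq0 a_neq0 b_neq0 q_lt1 ab1 a1 b1.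
split; [exact: cu | exact: ch |].
exact: (qpochs_inf_phi32 hK q_neq0 a_neq0 b_neq0 q_lt1 ab1 a1 b1).
Qed.
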